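(* Let $(X_1,Y_1),(X_2,Y_2),\ldots$ be independent (not necessarily identically distributed) random vectors in $\mathbb{R}^2$ with absolutely continuous bivariate distribution functions $F_1,F_2,\ldots$. For each $n\geq 2$ let $\tilde{\tau}_n$ and $\tau_n$ be, respectively, the rank and the theoretical Kendall correlation coefficients of $(X_1,Y_1),\ldots,(X_n,Y_n)$. Let $\tau\in[0,1]$ be the limit of the sequence $\tau_n$, i.e. $\tau_n\rightarrow\tau$ as $n\rightarrow\infty$. Then $$\tilde{\tau}_n\stackrel{p}{\rightarrow}\tau\quad (n\rightarrow\infty),$$ where $\stackrel{p}{\rightarrow}$ denotes convergence in probability.
   Context: Setting: $(X_i,Y_i)$ has distribution function $F_i(x,y)=P(X_i\leq x,\ Y_i\leq y)$ and density $f_i(x,y)$ with respect to Lebesgue measure on $\mathbb{R}^2$. Concomitants: for each $n$, let $X_{1,n}\leq\cdots\leq X_{n,n}$ be the order statistics of $X_1,\ldots,X_n$ (ties occur with probability zero). If $X_i=X_{j,n}$, then $Y_{j,n}:=Y_i$ is called the concomitant of $X_{j,n}$. So $Y_{1,n},\ldots,Y_{n,n}$ are the values $Y_1,\ldots,Y_n$ rearranged according to the increasing order of the $X$-values. Rank Kendall correlation coefficient: with $I_{ji}=I(Y_{j,n}\leq Y_{i,n})$, where $I$ is the indicator function, $$\tilde{\tau}_n=\frac{4\sum_{i=2}^n\sum_{j=1}^{i-1}I_{ji}}{n(n-1)}-1 .$$ Theoretical Kendall correlation coefficient (non-identically distributed case): $$\tau_n=\frac{4\sum_{i=1}^n\sum_{j=1,\,j\neq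 i}^n E[F_i(X_j,Y_j)]}{n(n-1)}-1=\frac{4\sum_{i=1}^n\sum_{j=1,\,j\neq i}^n \int_{\mathbb{R}^2}F_i(x,y)f_j(x,y)\,dx\,dy}{n(n-1)}-1 .$$ *)

(* Defs.v *)
From HB Require Import structures.
From mathcomp Require Import all_boot all_order all_algebra finmap.
From mathcomp Require Import all_classical all_reals all_analysis.

Set Implicit Arguments.
Unset Strict Implicit.
Unset Printing Implicit Defensive.

Import Order.TTheory GRing.Theory Num.Theory.
Import numFieldNormedType.Exports.

Local Open Scope classical_set_scope.
Local Open Scope ring_scope.

(* Sequences (X_i), (Y_i) are indexed from 0: the sample
   (X_1, Y_1), ..., (X_n, Y_n) is (X 0, Y 0), ..., (X n.-1, Y n.-1), and
   ranks 1, ..., n likewise become 0, ..., n.-1. *)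

Definition rvec (T : Type) (R : realType) (X Y : T -> R) (w : T) : R * R :=
  (X w, Y w).

Definition joint_cdf (d : measure_display) (T : measurableType d)
    (R : realType) (P : probability T R) (X Y : T -> R) (x y : R) : R :=
  fine (P [set w | X w <= x /\ Y w <= y]).

Definition is_joint_density (d : measure_display) (T : measurableType d)
    (R : realType) (P : probability T R) (X Y : T -> R) (f : R * R -> R) :
    Prop :=
  [/\ measurable_fun [set: R * R] f,
      forall z, 0 <= f z &
      forall B : set (R * R), measurable B ->
        P (rvec X Y @^-1` B) =
        (\int[lebesgue_measure \x lebesgue_measure]_(z in B) (f z)%:E)%E].

Definition independent_rvecs (d : measure_display) (T : measurableType d)
    (R : realType) (P : probability T R) (X Y : nat -> T -> R) : Prop :=
  forall (J : {fset nat}) (B : nat -> set (R * R)),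
    (forall i, measurable (B i)) ->
    P (\bigcap_(i in [set` J]) (rvec (X i) (Y i) @^-1` B i)) =
    (\prod_(i <- J) P (rvec (X i) (Y i) @^-1` B i))%E.

(* The indices 0, ..., n.-1 listed by increasing value of X_i(w), so that the
   order statistic X_{j,n}(w) is X (nth 0 (x_order X n w) j) w. Ties, a null
   event for continuous laws, are broken by the original index. *)
Definition x_order (T : Type) (R : realType) (X : nat -> T -> R) (n : nat)
    (w : T) : seq nat :=
  sort (fun i k => X i w <= X k w) (iota 0 n).

Definition concomitant (T : Type) (R : realType) (X Y : nat -> T -> R)
    (n j : nat) (w : T) : R :=
  Y (nth 0%N (x_order X n w) j) w.

Definition rank_kendall (T : Type) (R : realType) (X Y : nat -> T -> R)
    (n : nat) (w : T) : R :=
  4 * (\sum_(1 <= i < n) \sum_(0 <= j < i)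
         (concomitant X Y n j w <= concomitant X Y n i w)%R%:R)
    / (n%:R * (n%:R - 1)) - 1.

Definition kendall (d : measure_display) (T : measurableType d)
    (R : realType) (P : probability T R) (X Y : nat -> T -> R) (n : nat) : R :=
  4 * (\sum_(0 <= i < n) \sum_(0 <= j < n | j != i)
         fine ('E_P[fun w => joint_cdf P (X i) (Y i) (X j w) (Y j w)]))
    / (n%:R * (n%:R - 1)) - 1.

Definition cvg_in_probability (d : measure_display) (T : measurableType d)
    (R : realType) (P : probability T R) (U : nat -> T -> R) (l : R) : Prop :=
  forall e : R, 0 < e ->
    (fun n => P [set w | e <= `|U n w - l|]) @ \oo --> 0%E.

(* Main.v *)
(** Since [sort] is stable, the rank statistic is, ties included, the double sum
    over [i, j] of the indicators of the events [B (i, j)] that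
    [(X i, i) < (X j, j)] lexicographically and [Y i <= Y j].  A density makes
    ties in [X] null, so Fubini gives [P (B (i, j)) = E [F_i (X j, Y j)]], and
    the rank coefficient has mean exactly [tau_n].  Events with disjoint index pairs
    are independent, so only [O(n^3)] of the [n^4] covariances survive, and
    Chebyshev's inequality at scale [n^2] concludes. *)

Require Import Defs.
From HB Require Import structures.
From mathcomp Require Import all_boot all_order all_algebra finmap.
From mathcomp Require Import all_classical all_reals all_analysis.
From mathcomp Require Import measurable_realfun ring lra zify.

Set Implicit Arguments.
Unset Strict Implicit.
Unset Printing Implicit Defensive.

Import Order.TTheory GRing.Theory Num.Theory.
Import numFieldNormedType.Exports.

Local Open Scope classical_set_scope.
Local Open Scope ring_scope.

(** * The rank statistic as a sum of indicators over ordered pairs of indices *)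

(** With [r] asymmetric, [r] holds from the entry at position [j] to the one at position [i] exactly
    when [j < i], so a constraint on positions becomes a constraint on entries and the order of [s]
    disappears from the sum. *)
Lemma sum_pairwise (V : nmodType) (r : rel nat) (s : seq nat)
    (g : nat -> nat -> V) :
  pairwise r s -> (forall i j, r i j -> ~~ r j i) ->
  \sum_(0 <= i < size s) \sum_(0 <= j < i) g (nth 0%N s j) (nth 0%N s i) =
  \sum_(b <- s) \sum_(a <- s | r a b) g a b.
Proof.
move=> /(pairwiseP 0%N) rs asym; rewrite [RHS](big_nth 0%N).
apply: eq_big_nat => i /andP[_ ilt]; rewrite [RHS](big_nth 0%N).
rewrite (big_nat_widen _ _ _ _ _ (ltnW ilt)).
rewrite big_nat_cond [RHS]big_nat_cond; apply: eq_bigl => j /=.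
have [jlt|//] := ltnP j (size s); case: ltngtP => [ji|ij|->].
- by rewrite rs.
- by apply/esym/negbTE/asym/rs.
- by apply/esym/negbTE/negP => /= h; move: (asym _ _ h); rewrite h.
Qed.

(** [iota 0 n] is increasing and [sort] is stable, so tied values keep their index order: the list
    is arranged lexicographically by value, then by index. *)
Lemma x_order_pairwise (T : Type) (R : realType) (X : nat -> T -> R) n w :
  pairwise (fun i j => X i w < X j w ?<= if (i < j)%N) (x_order X n w).
Proof.
pose r : rel nat := fun i k => X i w <= X k w.
(* The right-hand side is the shape in which stability of [sort] is delivered: the index decides
   only when [r] holds both ways. *)
have rE i j : (X i w < X j w ?<= if (i < j)%N) = r i j && (r j i ==> (i < j)%N).
  by rewrite /r; case: (i < j)%N => /=; case: ltgtP.
suff: pairwise [rel i j | r i j && (r j i ==> (i < j)%N)] (x_order X n w).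
  by apply: sub_pairwise => i j /=; rewrite rE.
rewrite -sorted_pairwise; last first.
  move=> j i k /=; rewrite -!rE => ij jk.
  have := lteif_trans ij jk; apply: lteif_imply.
  by apply/implyP => /andP[]; exact: ltn_trans.
by apply: sort_iota_stable => i j; exact: le_total.
Qed.

Lemma rank_kendallE (T : Type) (R : realType) (X Y : nat -> T -> R) n w :
  rank_kendall X Y n w =
  4 * (\sum_(p : 'I_n * 'I_n)
        ((X p.1 w < X p.2 w ?<= if (p.1 < p.2)%N) && (Y p.1 w <= Y p.2 w))%:R)
    / (n%:R * (n%:R - 1)) - 1.
Proof.
rewrite /rank_kendall; congr (4 * _ / _ - 1).
pose g i j : R := (Y i w <= Y j w)%R%:R.
pose r i j := X i w < X j w ?<= if (i < j)%N.
have rasym i j : r i j -> ~~ r j i.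
  rewrite /r; case: ltngtP => [ij|ij|->] /=.
  - by rewrite -leNgt.
  - by rewrite -ltNge.
  - by rewrite ltxx.
have perms : perm_eq (x_order X n w) (iota 0 n) by rewrite /x_order perm_sort.
have sz : size (x_order X n w) = n by rewrite size_sort size_iota.
(* The outer sum of the definition starts at 1; the term [i = 0] is an empty sum and can be
   restored. *)
transitivity (\sum_(0 <= i < size (x_order X n w)) \sum_(0 <= j < i)
    g (nth 0%N (x_order X n w) j) (nth 0%N (x_order X n w) i)).
  rewrite sz; case: n {perms sz} => [|n]; first by rewrite !big_geq.
  by rewrite [RHS]big_nat_recl// [X in _ = X + _]big_geq// add0r big_add1.
rewrite (sum_pairwise _ (x_order_pairwise X n w))// (perm_big _ perms)/=.
under eq_bigr do rewrite (perm_big _ perms)/= big_mkcond.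
have iotaE (F : nat -> R) : \sum_(i <- iota 0 n) F i = \sum_(i < n) F i.
  by rewrite -[n in LHS]subn0 -/(index_iota 0 n) big_mkord.
rewrite exchange_big/= iotaE.
transitivity (\sum_(i < n) \sum_(j < n) (if r i j then g i j else 0)).
  by apply: eq_bigr => i _; exact: iotaE.
rewrite pair_bigA/=; apply: eq_bigr => -[i j] _ /=.
by rewrite /r /g; case: ifP.
Qed.

(** * Counting the pairs of index pairs with a common index *)

Definition share_index (p q : nat * nat) : bool :=
  [|| p.1 == q.1, p.1 == q.2, p.2 == q.1 | p.2 == q.2].

(** For each of the [n ^ 2] choices of [p], each of the four possible coincidences fixes one
    coordinate of [q] and leaves [n] choices for the other. *)
Lemma sum_share_index n :
  (\sum_(p : 'I_n * 'I_n) \sum_(q : 'I_n * 'I_n)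
     share_index (val p.1, val p.2) (val q.1, val q.2) <= 4 * n ^ 3)%N.
Proof.
have col (a : 'I_n) : (\sum_(q : 'I_n * 'I_n) (a == q.1) = n)%N.
  rewrite -(pair_big predT predT (fun i _ => nat_of_bool (a == i)))/=.
  rewrite (bigD1 a)//= eqxx sum1_card card_ord big1 ?addn0// => i.
  by rewrite eq_sym => /negbTE->; rewrite big1.
have row (a : 'I_n) : (\sum_(q : 'I_n * 'I_n) (a == q.2) = n)%N.
  rewrite -(pair_big predT predT (fun _ i => nat_of_bool (a == i)))/=.
  rewrite exchange_big/= (bigD1 a)//= eqxx sum1_card card_ord.
  rewrite big1 ?addn0// => i.
  by rewrite eq_sym => /negbTE->; rewrite big1.
apply: (@leq_trans (\sum_(p : 'I_n * 'I_n) 4 * n)); last first.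
  by rewrite sum_nat_const card_prod card_ord !expnS expn0; nia.
apply: leq_sum => p _; apply: (@leq_trans (\sum_(q : 'I_n * 'I_n)
    ((p.1 == q.1) + (p.1 == q.2) + ((p.2 == q.1) + (p.2 == q.2))))).
  apply: leq_sum => q _; rewrite /share_index/= !val_eqE.
  by do 4 case: (_ == _).
by rewrite !big_split/= !col !row; lia.
Qed.

(** * From rectangles to the product sigma-algebra *)

Section indep.
Context d (T : measurableType d) (R : realType) (P : probability T R).
Context d1 (T1 : measurableType d1) d2 (T2 : measurableType d2).

(** Dynkin's pi-lambda argument: for fixed [D], the sets [E] satisfying the product formula are
    closed under complements and disjoint countable unions, and the rectangles form a generating
    class stable under intersection. *)
Lemma preimage_pair_indep (Z1 : T -> T1) (Z2 : T -> T2) (D : set T) :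
  measurable_fun [set: T] Z1 -> measurable_fun [set: T] Z2 -> measurable D ->
  (forall A B, measurable A -> measurable B ->
    P (Z1 @^-1` A `&` Z2 @^-1` B `&` D) =
    (P (Z1 @^-1` A `&` Z2 @^-1` B) * P D)%E) ->
  forall E, measurable E ->
  P ((fun w => (Z1 w, Z2 w)) @^-1` E `&` D) =
  (P ((fun w => (Z1 w, Z2 w)) @^-1` E) * P D)%E.
Proof.
move=> mZ1 mZ2 mD indepD E.
set Z := fun w => (Z1 w, Z2 w).
have mZ : measurable_fun [set: T] Z by exact: measurable_fun_pair.
have mpre S : measurable S -> measurable (Z @^-1` S).
  by move=> mS; rewrite -[X in measurable X]setTI; exact: mZ.
rewrite [X in X E -> _]measurable_prod_measurableType.
move: E; apply: dynkin_induction => /=.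
- by rewrite measurable_prod_measurableType.
- move=> _ _ [A1 mA1 [A2 mA2 <-]] [B1 mB1 [B2 mB2 <-]].
  exists (A1 `&` B1); first exact: measurableI.
  by exists (A2 `&` B2); [exact: measurableI|rewrite setXI].
- by rewrite preimage_setT setTI probability_setT mul1e.
- by move=> _ [A mA [B mB <-]]; exact: indepD.
- move=> S mS PS; rewrite preimage_setC setIC -setDE measureD//; last 2 first.
  + exact: mpre.
  + by rewrite ltey_eq fin_num_measure.
  rewrite setIC [X in (_ - X)%E]PS probability_setC; last exact: mpre.
  by rewrite muleBl ?mul1e//; exact: fin_num_measure.
- move=> F mF tF PF; rewrite preimage_bigcup setI_bigcupl.
  have tZF : trivIset setT (fun k => Z @^-1` F k).
    apply/trivIsetP => i j _ _ ij; rewrite -preimage_setI.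
    by move/trivIsetP : tF => /(_ i j Logic.I Logic.I ij) ->;
      rewrite preimage_set0.
  rewrite measure_bigcup//=; last 2 first.
  + by move=> k _; apply: measurableI => //; exact: mpre.
  + apply/trivIsetP => i j _ _ ij; rewrite setIACA.
    by move/trivIsetP : tZF => /(_ i j Logic.I Logic.I ij) ->; rewrite set0I.
  rewrite measure_bigcup//=; last by move=> k _; exact: mpre.
  under eq_eseriesr do rewrite PF muleC.
  by rewrite -[P D]fineK ?fin_num_measure// nneseriesZl// muleC.
Qed.

(** The law of the pair agrees with the product of the marginal laws on rectangles, hence
    everywhere; the product measure of [E] is the integral of the measures of its sections. *)
Lemma prob_preimage_pair (Z1 : {RV P >-> T1}) (Z2 : {RV P >-> T2}) :
  (forall A B, measurable A -> measurable B ->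
    P (Z1 @^-1` A `&` Z2 @^-1` B) = (P (Z1 @^-1` A) * P (Z2 @^-1` B))%E) ->
  forall E, measurable E ->
  P ((fun w => (Z1 w, Z2 w)) @^-1` E) =
  (\int[P]_w P (Z2 @^-1` (xsection E (Z1 w))))%E.
Proof.
move=> indep E mE.
have mZ : measurable_fun [set: T] (fun w => (Z1 w, Z2 w)).
  exact: measurable_fun_pair.
pose Z : {RV P >-> (T1 * T2)%type} := HB.pack (fun w => (Z1 w, Z2 w))
  (isMeasurableFun.Build _ _ _ _ _ mZ).
rewrite -[LHS]/(distribution P Z E).
rewrite -(@product_measure_unique _ _ _ _ R (distribution P Z1)
  (distribution P Z2) (distribution P Z) indep E mE).
rewrite /product_measure1 ge0_integral_distribution//.
exact: measurable_fun_xsection.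
Qed.

End indep.

(** * Chebyshev's inequality for sums of indicators *)

Section deviation.
Context d (T : measurableType d) (R : realType) (P : probability T R).

Lemma Lfun_indic (A : set T) : measurable A -> (\1_A : T -> R) \in Lfun P 1.
Proof.
by move=> mA; apply/Lfun1_integrable/integrable_indic.
Qed.

Lemma covariance_indic (A B : set T) : measurable A -> measurable B ->
  covariance P (\1_A) (\1_B) = (P (A `&` B) - P A * P B)%E.
Proof.
move=> mA mB; have mAB := measurableI _ _ mA mB.
rewrite covarianceE ?Lfun_indic//.
  by rewrite -[(_ * _)%R]/(\1_A \* \1_B) -indicI !expectation_indic.
by rewrite -[(_ * _)%R]/(\1_A \* \1_B) -indicI Lfun_indic.
Qed.

(** The relation [r] marks the pairs of events that may be dependent. The variance is the sum of all
    covariances: unmarked pairs contribute 0, marked ones at most 1. *)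
Lemma sum_indic_deviation (I : finType) (B : I -> set T) (r : rel I) (a : R) :
  0 < a -> (forall p, measurable (B p)) ->
  (forall p q, ~~ r p q -> P (B p `&` B q) = (P (B p) * P (B q))%E) ->
  (P [set w | (a <= `|\sum_p \1_(B p) w - \sum_p fine (P (B p))|)%R] <=
   ((\sum_p \sum_q r p q)%:R / a ^+ 2)%:E)%E.
Proof.
move=> a0 mB indep.
pose c p : R := fine (P (B p)).
pose U w : R := \sum_p (\1_(B p) w - c p).
have mU : measurable_fun [set: T] U.
  by apply: measurable_sum => p; apply: measurable_funD.
rewrite [X in P X](_ : _ = [set w | a <= `|U w|]); last first.
  by apply/seteqP; split => w /=; rewrite /U sumrB.
set S := [set w | _].
have mS : measurable S.
  rewrite -[S]setTI.
  apply: (@measurable_fun_le _ _ R setT (cst a) (fun w => `|U w|)) => //.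
  exact: measurableT_comp.
pose h p q w : R := (\1_(B p) w - c p) * (\1_(B q) w - c q).
have mh p q : measurable_fun [set: T] (h p q).
  by apply: measurable_funM; apply: measurable_funD.
have inth p q : P.-integrable [set: T] (EFin \o h p q).
  apply: measurable_bounded_integrable => //.
    by rewrite ltey_eq fin_num_measure.
  have dev1 k w : `|\1_(B k) w - c k| <= 1.
    have c0 : 0 <= c k by exact: fine_ge0.
    have c1 : c k <= 1.
      by rewrite -lee_fin fineK ?fin_num_measure// probability_le1.
    by rewrite indicE ler_norml; case: (w \in B k) => /=; apply/andP; lra.
  exists 1; split=> // M M1 w _ /=; rewrite normrM.
  by apply: le_trans (ltW M1); rewrite mulr_ile1.
have Eh p q : (\int[P]_w (h p q w)%:E = P (B p `&` B q) - P (B p) * P (B q))%E.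
  by rewrite -covariance_indic// covariance.unlock !expectation_indic//
    expectation.unlock.
have Eh_le p q : (\int[P]_w (h p q w)%:E <= (r p q)%:R%:E)%E.
  rewrite Eh; case: (boolP (r p q)) => [_|/indep ->]; last first.
    by rewrite subee// fin_numM// fin_num_measure.
  (* Dropping the nonnegative product [P (B p) * P (B q)] bounds the covariance by a probability. *)
  apply: (@le_trans _ _ (P (B p `&` B q))); first by rewrite leeBlDr ?leeDl//
    ?fin_numM ?fin_num_measure// mule_ge0.
  by apply: probability_le1; exact: measurableI.
have U2E w : U w ^+ 2 = \sum_p \sum_q h p q w.
  by rewrite expr2 big_distrlr.
rewrite mulrC EFinM -lee_pdivrMl ?invr_gt0 ?exprn_gt0// invrK.
(* Markov's inequality for the square: [a ^+ 2 * \1_S] lies below [U ^+ 2] pointwise. *)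
apply: (@le_trans _ _ (\int[P]_w (U w ^+ 2)%:E)%E).
  rewrite -[S]setIT -integral_indic// -ge0_integralZl//; last 2 first.
  - exact/measurable_EFinP.
  - by rewrite lee_fin sqr_ge0.
  apply: ge0_le_integral => //.
  - by move=> w _; rewrite -EFinM lee_fin mulr_ge0 ?sqr_ge0.
  - by apply/measurable_EFinP; apply: measurable_funM.
  - by apply/measurable_EFinP; apply: measurable_funX.
  - move=> w _; rewrite -EFinM lee_fin indicE.
    case: (boolP (w \in S)) => [|_]; last by rewrite mulr0 sqr_ge0.
    rewrite inE /S/= mulr1 -(real_normK (num_real (U w))).
    by move=> aU; apply: lerXn2r; rewrite ?nnegrE// ltW.
under eq_integral do rewrite U2E -sumEFin.
under eq_integral do under eq_bigr do rewrite -sumEFin.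
rewrite integral_sum//; last first.
  by move=> p; apply: integrable_sum => // q _; exact: inth.
rewrite natr_sum -sumEFin; apply: lee_sum => p _.
rewrite integral_sum//; last by move=> q; exact: inth.
rewrite natr_sum -sumEFin; apply: lee_sum => q _.
exact: Eh_le.
Qed.

End deviation.

(** * Concordance probabilities as expectations of the distribution function *)

(** Lets the lemmas on random variables apply to [rvec X Y] as a single random vector. *)
HB.instance Definition _ (d : measure_display) (T : measurableType d)
    (R : realType) (P : probability T R) (X Y : {RV P >-> R}) :=
  isMeasurableFun.Build _ _ _ _ (rvec X Y)
    (measurable_fun_pair (measurable_funPT X) (measurable_funPT Y)).

Lemma measurable_lteif (R : realType) d (S : measurableType d) (b : bool)
    (g h : S -> R) :
  measurable_fun [set: S] g -> measurable_fun [set: S] h ->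
  measurable [set z | g z < h z ?<= if b].
Proof.
move=> mg mh.
have e (k : S -> bool) : measurable_fun [set: S] k -> measurable [set z | k z].
  by move=> mk; rewrite -[X in measurable X]setTI;
    exact: (mk measurableT [set true]).
by case: b => /=; apply: e;
  [exact: measurable_fun_ler|exact: measurable_fun_ltr].
Qed.

Section kendall.
Context d (T : measurableType d) (R : realType) (P : probability T R).
Implicit Types (X Y : {RV P >-> R}).

(** A vertical line is Lebesgue-null in the plane, so the density integrates to 0 over it. *)
Lemma density_null_set1 X Y f (a : R) : is_joint_density P X Y f ->
  P [set w | X w = a] = 0%E.
Proof.
case=> mf f0 fP.
have mB : measurable ([set a] `*` [set: R]) by exact: measurableX.
rewrite [X in P X](_ : _ = rvec X Y @^-1` ([set a] `*` [set: R])); last first.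
  by apply/seteqP; split => w //= [].
rewrite fP//; apply: null_set_integral => //=.
  by apply/measurable_EFinP; exact: measurable_funTS.
by rewrite product_measure1E//= lebesgue_measure_set1 mul0e.
Qed.

(* The dominating point comes first, so that the [xsection]s are quadrants whose
   probability is a value of [joint_cdf]. *)
Definition concordant (b : bool) : set ((R * R) * (R * R)) :=
  [set z | z.2.1 < z.1.1 ?<= if b] `&` [set z | z.2.2 <= z.1.2].

Lemma measurable_concordant b : measurable (concordant b).
Proof.
apply: measurableI.
  by apply: measurable_lteif; apply: measurableT_comp.
by apply: (measurable_lteif true); apply: measurableT_comp.
Qed.

Lemma concordantE (X1 Y1 X2 Y2 : T -> R) b :
  [set w | (X1 w < X2 w ?<= if b) && (Y1 w <= Y2 w)] =
  (fun w => (rvec X2 Y2 w, rvec X1 Y1 w)) @^-1` concordant b.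
Proof. by apply/seteqP; split => w /=; [case/andP|case=> /= -> ->]. Qed.

(** By Fubini, the second vector can be frozen at [(x, y)]; what is left is the probability that the
    first one falls in the quadrant below [(x, y)], whose right edge is included or not according to
    [b]. *)
Lemma prob_concordant X1 Y1 X2 Y2 f b :
  is_joint_density P X1 Y1 f ->
  (forall A B, measurable A -> measurable B ->
    P (rvec X2 Y2 @^-1` A `&` rvec X1 Y1 @^-1` B) =
    (P (rvec X2 Y2 @^-1` A) * P (rvec X1 Y1 @^-1` B))%E) ->
  P [set w | (X1 w < X2 w ?<= if b) && (Y1 w <= Y2 w)] =
  'E_P[fun w => joint_cdf P X1 Y1 (X2 w) (Y2 w)]%E.
Proof.
move=> fden indep.
rewrite concordantE prob_preimage_pair//; last exact: measurable_concordant.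
rewrite expectation.unlock; apply: eq_integral => w _.
rewrite /joint_cdf fineK; last first.
  apply: fin_num_measure; apply: measurableI.
    exact: (measurable_lteif true).
  exact: (measurable_lteif true).
set x := X2 w; set y := Y2 w.
have mA c : measurable [set w' | (X1 w' < x ?<= if c) /\ Y1 w' <= y].
  by apply: measurableI; [exact: measurable_lteif|
    exact: (measurable_lteif true)].
transitivity (P [set w' | (X1 w' < x ?<= if b) /\ Y1 w' <= y]).
  by congr (P _); apply/seteqP; split => w';
    rewrite /xsection /concordant /= inE.
have mN : measurable [set w' | X1 w' = x].
  by rewrite -[X in measurable X]setTI;
    exact: (measurable_funPT X1 measurableT [set x]).
have N0 : P [set w' | X1 w' = x] = 0%E by exact: density_null_set1 fden.
(* Adjoining the null line [X1 = x] changes the probability of neither quadrant and makes the two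
   sets equal. *)
have mu c := measureU0 (mA c) mN N0.
rewrite -mu -[RHS](mu true); congr (P _); apply/seteqP; split=> w' /=.
  by case=> [[/lteifW xlt ylt]|]; [left|right].
case=> [[]|]; [|by right].
by rewrite le_eqVlt => /predU1P[->|xlt yle]; [right|left; rewrite lteifS].
Qed.
End kendall.

(** * Independence of events carried by disjoint index pairs *)

Section independence.
Context d (T : measurableType d) (R : realType) (P : probability T R).

Lemma independent_rvecs_seq (X Y : nat -> T -> R) (s : seq nat)
    (B : nat -> set (R * R)) :
  independent_rvecs P X Y -> uniq s -> (forall i, measurable (B i)) ->
  P (\big[setI/setT]_(i <- s) (rvec (X i) (Y i) @^-1` B i)) =
  (\prod_(i <- s) P (rvec (X i) (Y i) @^-1` B i))%E.
Proof.
move=> indep us mB; have pes : perm_eq s (enum_fset [fset i in s]%fset).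
  apply: uniq_perm => // [|i]; first exact: fset_uniq.
  by rewrite -[RHS]/(i \in [fset i in s]%fset) inE.
rewrite (perm_big _ pes) [RHS](perm_big _ pes) -indep//; congr (P _).
by rewrite -bigcap_seq.
Qed.

Variables X Y : nat -> {RV P >-> R}.
Hypothesis indep : independent_rvecs P X Y.
Let Z i := rvec (X i) (Y i).

Lemma rvec_indep2 i j A B : i != j -> measurable A -> measurable B ->
  P (Z i @^-1` A `&` Z j @^-1` B) = (P (Z i @^-1` A) * P (Z j @^-1` B))%E.
Proof.
move=> ij mA mB; have us : uniq [:: i; j] by rewrite /= inE ij.
have := independent_rvecs_seq (B := fun m => if m == i then A else B) indep us.
rewrite !big_cons !big_nil setIT mule1 eqxx eq_sym (negbTE ij); apply.
by move=> m; case: ifP.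
Qed.

Lemma rvec_indep4 i j k l A B C D : uniq [:: i; j; k; l] ->
  measurable A -> measurable B -> measurable C -> measurable D ->
  P (Z i @^-1` A `&` Z j @^-1` B `&` (Z k @^-1` C `&` Z l @^-1` D)) =
  (P (Z i @^-1` A `&` Z j @^-1` B) * P (Z k @^-1` C `&` Z l @^-1` D))%E.
Proof.
move=> us mA mB mC mD; pose S := [:: A; B; C; D].
have mS m : measurable (nth setT S m).
  by case: m => [|[|[|[|m]]]] //=; rewrite nth_nil.
(* Each of the four indices receives its own set through its position in the list; any other index
   falls on the default [setT]. *)
have := independent_rvecs_seq
  (B := fun m => nth setT S (index m [:: i; j; k; l]))
  indep us (fun m => mS _).
move: us; rewrite /= !inE !negb_or.
move=> /and4P[/and3P[ij ik il] /andP[jk jl] kl _].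
rewrite !big_cons !big_nil setIT mule1 !eqxx !(negbTE ij, negbTE ik, negbTE il,
  negbTE jk, negbTE jl, negbTE kl)/= => h.
by rewrite -setIA h (rvec_indep2 ij)// (rvec_indep2 kl)// muleA.
Qed.

(** The pi-lambda argument is used twice, first reducing [E] to a rectangle with [F] fixed, then [F]
    with that rectangle fixed; four-fold independence settles the rectangles. *)
Lemma rvec_pair_indep i j k l E F : uniq [:: i; j; k; l] ->
  measurable E -> measurable F ->
  P ((fun w => (Z i w, Z j w)) @^-1` E `&` (fun w => (Z k w, Z l w)) @^-1` F) =
  (P ((fun w => (Z i w, Z j w)) @^-1` E) *
   P ((fun w => (Z k w, Z l w)) @^-1` F))%E.
Proof.
have mZ m : measurable_fun [set: T] (Z m).
  exact: (@measurable_funPT _ _ _ _ (rvec (X m) (Y m))).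
have mpre m A : measurable A -> measurable (Z m @^-1` A).
  by move=> mA; rewrite -[X in measurable X]setTI; exact: mZ.
move=> us mE mF; apply: preimage_pair_indep => //.
  rewrite -[X in measurable X]setTI.
  by apply: (measurable_fun_pair (mZ k) (mZ l)).
move=> A B mA mB; rewrite setIC muleC; apply: preimage_pair_indep => //.
  by apply: measurableI; exact: mpre.
by move=> C D mC mD; rewrite setIC muleC; exact: rvec_indep4.
Qed.

End independence.

Theorem theorem2p3 (d : measure_display) (T : measurableType d) (R : realType)
    (P : probability T R) (X Y : nat -> {RV P >-> R}) (f : nat -> R * R -> R)
    (tau : R)
    (hindep : independent_rvecs P X Y)
    (hdens : forall i, is_joint_density P (X i) (Y i) (f i))
    (htau01 : 0 <= tau <= 1)
    (htau : kendall P X Y n @[n --> \oo] --> tau) :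
  cvg_in_probability P (rank_kendall X Y) tau.
Proof.
pose B (p : nat * nat) :=
  [set w | (X p.1 w < X p.2 w ?<= if (p.1 < p.2)%N) && (Y p.1 w <= Y p.2 w)].
have BE p : B p = (fun w => (rvec (X p.2) (Y p.2) w, rvec (X p.1) (Y p.1) w))
    @^-1` concordant (p.1 < p.2)%N by exact: concordantE.
have mB p : measurable (B p).
  rewrite BE -[X in measurable X]setTI.
  apply: (measurable_fun_pair (measurable_funPT (rvec _ _))
    (measurable_funPT (rvec _ _))) => //; exact: measurable_concordant.
(* Diagonal pairs give empty events, so the sums may run over all of ['I_n * 'I_n]. *)
have B0 p : p.1 == p.2 -> B p = set0.
  by move=> /eqP pp; rewrite /B pp ltnn; apply/seteqP;
    split => w //=; rewrite ltxx.
have PB p : p.1 != p.2 -> P (B p) =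
    'E_P[fun w => joint_cdf P (X p.1) (Y p.1) (X p.2 w) (Y p.2 w)]%E.
  move=> pp; apply: prob_concordant (hdens p.1) _ => C D mC mD.
  by apply: rvec_indep2 => //; rewrite eq_sym.
have indB p q : ~~ share_index p q -> P (B p `&` B q) = (P (B p) * P (B q))%E.
  rewrite /share_index !negb_or => /and4P[p1q1 p1q2 p2q1 p2q2].
  (* Disjoint pairs have four distinct indices only off the diagonal; an empty event is independent
     of everything. *)
  have [/B0 ->|pp] := boolP (p.1 == p.2); first by rewrite set0I measure0 mul0e.
  have [/B0 ->|qq] := boolP (q.1 == q.2); first by rewrite setI0 measure0 mule0.
  rewrite !BE; apply: rvec_pair_indep => //; try exact: measurable_concordant.
  by rewrite /= !inE !negb_or p1q1 p1q2 p2q1 p2q2 eq_sym pp eq_sym qq.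
pose v n (p : 'I_n * 'I_n) : nat * nat := (val p.1, val p.2).
pose c n : R := \sum_(p : 'I_n * 'I_n) fine (P (B (v n p))).
pose S n w : R := \sum_(p : 'I_n * 'I_n) \1_(B (v n p)) w.
have rankE n w : rank_kendall X Y n w = 4 * S n w / (n%:R * (n%:R - 1)) - 1.
  rewrite rank_kendallE; congr (4 * _ / _ - 1); apply: eq_bigr => p _.
  by rewrite indicE mem_setE.
(* The centring constant [c n] yields [kendall] exactly, so the only bias is the distance from
   [kendall] to [tau]. *)
have kendallE n : kendall P X Y n = 4 * c n / (n%:R * (n%:R - 1)) - 1.
  rewrite /kendall; congr (4 * _ / _ - 1); rewrite big_mkord.
  under eq_bigr do rewrite big_mkord.
  rewrite pair_big_dep/= [RHS](bigID (fun p => p.2 != p.1))/=.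
  rewrite [X in _ = _ + X]big1 ?addr0.
    by apply: eq_bigr => p pp; rewrite PB// eq_sym.
  by move=> p /negbNE pp; rewrite B0 ?measure0// eq_sym.
have mS n : measurable_fun [set: T] (S n).
  by apply: measurable_sum => p; exact: measurable_indic.
have mabs (U : T -> R) (b : R) : measurable_fun [set: T] U ->
    measurable [set w | b <= `|U w|].
  move=> mU; apply: (measurable_lteif true) => //.
  exact: measurableT_comp.
move=> e e0.
(* Bounds [4 n^3 / a^2] with [a = e n (n - 1) / 8] by [K / (n + 1)], because
   [n (n + 1) <= 9 (n - 1)^2] when [2 <= n]. *)
pose K : R := 2304 / e ^+ 2.
have bound : \forall n \near \oo,
    (P [set w | (e <= `|rank_kendall X Y n w - tau|)%R] <=
     (K * harmonic n)%:E)%E.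
  have e2 : 0 < e / 2 by rewrite divr_gt0.
  move/cvgrPdist_lt : htau => /(_ _ e2) near_tau.
  near=> n.
  have n2 : (2 <= n)%N by near: n; exact: nbhs_infty_ge.
  have taun : `|tau - kendall P X Y n| < e / 2 by near: n.
  have n2R : (2 : R) <= n%:R by rewrite ler_nat.
  pose N : R := n%:R * (n%:R - 1).
  have N0 : 0 < N by rewrite mulr_gt0//; lra.
  pose a := e * N / 8.
  have a0 : 0 < a by rewrite divr_gt0// mulr_gt0.
  apply: (@le_trans _ _ (P [set w | (a <= `|S n w - c n|)%R])).
    apply: le_measure; rewrite ?inE.
    - under eq_set do rewrite rankE.
      apply: mabs; apply: measurable_funB => //; apply: measurable_funB => //.
      by apply: measurable_funM => //; apply: measurable_funM.
    - by apply: mabs; apply: measurable_funB.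
    (* If the sum were within [a] of its mean, then, as [4 / N * a = e / 2], the rank coefficient
       would be within [e / 2] of [kendall], itself within [e / 2] of [tau]. *)
    - move=> w /= elt; rewrite leNgt; apply/negP => Slt.
      have rk : rank_kendall X Y n w - kendall P X Y n = 4 / N * (S n w - c n).
        by rewrite rankE kendallE -/N; field; rewrite gt_eqF.
      have : `|rank_kendall X Y n w - kendall P X Y n| < e / 2.
        rewrite rk normrM gtr0_norm ?divr_gt0//.
        rewrite (_ : e / 2 = 4 / N * a) ?ltr_pM2l ?divr_gt0//.
        by rewrite /a; field; rewrite gt_eqF.
      move=> rklt.
      move: (ler_distD (kendall P X Y n) (rank_kendall X Y n w) tau).
      rewrite distrC in taun; move=> /le_lt_trans /(_ (ltrD rklt taun)).
      by rewrite -splitr ltNge elt.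
  apply: le_trans (sum_indic_deviation
    (r := fun p q => share_index (v n p) (v n q)) a0 _ _) _ => //.
    by move=> p q /indB.
  rewrite lee_fin; apply: (@le_trans _ _ ((4 * n ^ 3)%N%:R / a ^+ 2)).
    by rewrite ler_pM2r ?invr_gt0 ?exprn_gt0// ler_nat; exact: sum_share_index.
  rewrite natrM natrX ler_pdivrMr ?exprn_gt0// /K /a /N /harmonic/=.
  rewrite -[n.+1%:R]natr1.
  set x : R := n%:R in n2R *.
  rewrite (_ : 2304 / e ^+ 2 / (x + 1) * (e * (x * (x - 1)) / 8) ^+ 2 =
    36 * (x * (x - 1)) ^+ 2 / (x + 1)); last first.
    by field; rewrite gt_eqF//=; apply/eqP; lra.
  rewrite ler_pdivlMr; last lra.
  have x2 : 0 <= x ^+ 2 by exact: sqr_ge0.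
  rewrite (_ : 4 * x ^+ 3 * (x + 1) = x ^+ 2 * (4 * (x * (x + 1))));
    last by ring.
  rewrite (_ : 36 * (x * (x - 1)) ^+ 2 = x ^+ 2 * (36 * (x - 1) ^+ 2));
    last by ring.
  by apply: ler_wpM2l => //; nra.
(* [harmonic n] is the inverse of [n + 1], so the upper bound tends to 0. *)
apply: (@squeeze_cvge _ _ _ _ (cst 0%E) _ (fun n => (K * harmonic n)%:E)).
- by near=> n; rewrite measure_ge0/=; near: n.
- exact: cvg_cst.
- apply: cvg_EFin; first by near=> n.
  rewrite -[0](mulr0 K); apply: cvgMr; exact: cvg_harmonic.
Unshelve. all: by end_near. Qed.
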